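(* Let $X$ be a topological space. The set $\mathscr{U}_{B^*}$ of all units of the ring $B_1^*(X)$ is an open set in $B_1^*(X)$ with the uniform norm topology.
   Context: A Baire one function on a topological space $X$ is a function $f:X\to\mathbb{R}$ that is the pointwise limit of a sequence of continuous real-valued functions on $X$. $B_1^*(X)$ is the commutative ring, under pointwise operations, of all bounded Baire one functions on $X$. The uniform norm topology on $B_1^*(X)$ is the topology induced by the norm $\|f\|=\sup_{x\in X}|f(x)|$. *)

(* Defs.v *)
From HB Require Import structures.
From mathcomp Require Import all_boot all_order all_algebra.
From mathcomp Require Import all_classical all_reals all_analysis.
Set Implicit Arguments.
Unset Strict Implicit.
Unset Printing Implicit Defensive.
Import Order.TTheory GRing.Theory Num.Theory.
Import numFieldNormedType.Exports.
Local Open Scope classical_set_scope.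
Local Open Scope ring_scope.

(* [GRing.unit] requires a [unitRingType], hence [1 != 0]; this version also
   covers the zero ring, which is [B1star R X] for an empty [X]. *)
Definition is_unit {A : comPzRingType} (a : A) : Prop := exists b : A, a * b = 1.

Definition baire_one {R : realType} {X : topologicalType} (f : X -> R) : Prop :=
  exists u : nat -> X -> R,
    (forall n, continuous (u n)) /\ (forall x, u n x @[n --> \oo] --> f x).

Definition b1star {R : realType} {X : topologicalType} : {pred X -> R} :=
  mem [set f : X -> R | baire_one f /\ bounded_fun f].

Lemma b1starP (R : realType) (X : topologicalType) (f : X -> R) :
  reflect (baire_one f /\ exists M : R, forall x, `|f x| <= M)
    (f \in b1star).
Proof.
apply: (iffP idP); rewrite inE /=.
- case=> bf [M [_ hM]]; split => //; exists (M + 1) => x.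
  by apply: hM => //; rewrite ltrDl.
- case=> bf [M hM]; split => //; exists M; split; first exact: num_real.
  by move=> N MN x _; apply: le_trans (hM x) (ltW MN).
Qed.

Lemma b1star_submod_closed (R : realType) (X : topologicalType) :
  submod_closed (@b1star R X).
Proof.
split.
  apply/b1starP; split; last by exists 0 => x; rewrite normr0.
  exists (fun=> cst 0); split=> [_|x]; first exact: cst_continuous.
  exact: cvg_cst.
move=> a f g /b1starP[[u [uc uf]] [M hM]] /b1starP[[v [vc vg]] [N hN]].
apply/b1starP; split; last first.
  exists (`|a| * M + N) => x; apply: le_trans (ler_normD _ _) _.
  by rewrite lerD// normrM ler_wpM2l.
exists (fun n x => a * u n x + v n x); split=> [n x|x].
  apply: cvgD; last exact: vc.
  by apply: cvgM; [exact: cvg_cst|exact: uc].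
by apply: cvgD; [apply: cvgM; [exact: cvg_cst|exact: uf]|exact: vg].
Qed.

Lemma b1star_mulr_closed (R : realType) (X : topologicalType) :
  mulr_closed (@b1star R X).
Proof.
split.
  apply/b1starP; split; last by exists 1 => x; rewrite normr1.
  exists (fun=> cst 1); split=> [_|x]; first exact: cst_continuous.
  exact: cvg_cst.
move=> f g /b1starP[[u [uc uf]] [M hM]] /b1starP[[v [vc vg]] [N hN]].
apply/b1starP; split; last first.
  by exists (M * N) => x; rewrite normrM ler_pM.
exists (fun n x => u n x * v n x); split=> [n x|x].
  by apply: cvgM; [exact: uc|exact: vc].
by apply: cvgM; [exact: uf|exact: vg].
Qed.

HB.instance Definition _ (R : realType) (X : topologicalType) :=
  GRing.isSubmodClosed.Build R (X -> R) b1star (@b1star_submod_closed R X).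
HB.instance Definition _ (R : realType) (X : topologicalType) :=
  GRing.isMulClosed.Build (X -> R) b1star (@b1star_mulr_closed R X).

Record B1star (R : realType) (X : topologicalType) := MkB1star {
  B1star_fun :> X -> R;
  _ : B1star_fun \in b1star
}.

Section B1star_ring.
Variables (R : realType) (X : topologicalType).

HB.instance Definition _ := [isSub for @B1star_fun R X].
HB.instance Definition _ := [Choice of B1star R X by <:].
HB.instance Definition _ := [SubChoice_isSubLmodule of B1star R X by <:].
HB.instance Definition _ := GRing.SubZmodule_isSubPzRing.Build (X -> R) b1star
  (B1star R X) (GRing.subringClosedP _).
HB.instance Definition _ := GRing.SubPzRing_isSubComPzRing.Build (X -> R) b1star
  (B1star R X).

End B1star_ring.

Section uniform_norm.
Variables (R : realType) (X : topologicalType).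
Implicit Types f g : B1star R X.

(* When [X] is empty this is [sup set0 = 0]. *)
Definition unorm f : R := sup (range (fun x => `|f x|)).

Lemma unorm_ge f x : `|f x| <= unorm f.
Proof.
have /b1starP[_ [M hM]] := valP f.
by apply: ub_le_sup; [exists M => _ [y _ <-]; exact: hM|exists x].
Qed.

Lemma unorm_le f (M : R) : 0 <= M -> (forall x, `|f x| <= M) -> unorm f <= M.
Proof.
move=> M0 hM; have [[x _]|/set0P/negP/negPn/eqP X0] := pselect ([set: X] !=set0).
  by apply: ge_sup => [|_ [y _ <-]//]; exists `|f x|, x.
by rewrite /unorm X0 image_set0 sup0.
Qed.

Lemma unorm_ge0 f : 0 <= unorm f.
Proof.
have [[x _]|/set0P/negP/negPn/eqP X0] := pselect ([set: X] !=set0).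
  exact: le_trans (unorm_ge f x).
by rewrite /unorm X0 image_set0 sup0.
Qed.

Lemma unormD f g : unorm (f + g) <= unorm f + unorm g.
Proof.
apply: unorm_le => [|x]; first by rewrite addr_ge0 ?unorm_ge0.
by apply: le_trans (ler_normD _ _) _; rewrite lerD ?unorm_ge.
Qed.

Lemma unormZ (a : R) f : unorm (a *: f) = `|a| * unorm f.
Proof.
have le (b : R) h : unorm (b *: h) <= `|b| * unorm h.
  apply: unorm_le => [|x]; first by rewrite mulr_ge0 ?unorm_ge0.
  by rewrite [_ x]/(b * h x) normrM ler_wpM2l ?unorm_ge.
apply/eqP; rewrite eq_le le /=; have [->|a0] := eqVneq a 0.
  by rewrite normr0 mul0r unorm_ge0.
rewrite -ler_pdivlMl ?normr_gt0// -normfV.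
by rewrite -{1}[f]scale1r -(mulVf a0) -scalerA le.
Qed.

Lemma unorm_eq0 f : unorm f = 0 -> f = 0.
Proof.
move=> f0; apply/val_inj/funext => x; apply/eqP.
by rewrite -normr_le0 -f0 unorm_ge.
Qed.

HB.instance Definition _ :=
  Lmodule_isNormed.Build R (B1star R X) unormD unormZ unorm_eq0.

End uniform_norm.

(* Main.v *)
(* A unit [f] with inverse [b] satisfies [|f| >= 1 / (|b| + 1)] everywhere, so
   every [g] uniformly close to [f] is bounded away from [0] as well, and a
   bounded Baire one function bounded away from [0] is invertible: if continuous
   [u n] converge to [g] and [|g| >= d > 0], then the continuous functions
   [u n / max (u n ^ 2, d ^ 2)] converge to [g / g ^ 2 = 1 / g]. *)
Require Import Defs.
From mathcomp Require Import all_boot all_order all_algebra.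
From mathcomp Require Import all_classical all_reals all_analysis.
From mathcomp Require Import lra.
Import Order.TTheory GRing.Theory Num.Theory.
Import numFieldNormedType.Exports.
Local Open Scope classical_set_scope.
Local Open Scope ring_scope.

Lemma baire_one_inv (R : realType) (X : topologicalType) (g : X -> R) (d : R) :
  0 < d -> (forall x, d <= `|g x|) -> baire_one g ->
  baire_one (fun x => (g x)^-1).
Proof.
move=> d0 dg [u [uc ug]].
have max_neq0 (t : R) : Num.max (t * t) (d * d) != 0.
  by rewrite gt_eqF// lt_max (mulr_gt0 d0 d0) orbT.
(* The filter is arbitrary so that one argument gives both continuity in [x] and convergence in
   [n]. *)
have cvg_quot (T : Type) (F : set_system T) (FF : Filter F) (h : T -> R) (l : R) :
    h @ F --> l ->
    (fun t => h t / Num.max (h t * h t) (d * d)) @ F -->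
    l / Num.max (l * l) (d * d).
  move=> hl; apply: cvgM => //; apply: cvgV => //.
  have qc : continuous (fun t : R => Num.max (t * t) (d * d)).
    move=> t; apply: (@continuous_max R R (fun s => s * s) (cst (d * d))); last exact: cvg_cst.
    by apply: cvgM; exact: cvg_id.
  exact: cvg_comp hl (qc l).
exists (fun n x => u n x / Num.max (u n x * u n x) (d * d)); split=> [n x|x].
  exact: cvg_quot (uc n x).
have gx0 : g x != 0 by rewrite -normr_gt0 (lt_le_trans d0).
have -> : (g x)^-1 = g x / Num.max (g x * g x) (d * d).
  rewrite max_l; first by rewrite invfM mulVKf.
  by rewrite -!expr2 -(real_normK (num_real (g x))) lerXn2r ?nnegrE ?(ltW d0).
exact: cvg_quot (ug x).
Qed.

(** The bound [d] serves twice: it makes the reciprocal Baire one and bounds it by [d^-1]. *)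
Lemma is_unit_B1star (R : realType) (X : topologicalType) (g : B1star R X)
    (d : R) :
  0 < d -> (forall x, d <= `|g x|) -> is_unit g.
Proof.
move=> d0 dg; have /b1starP[bg _] := valP g.
have gV : (fun x => (g x)^-1) \in b1star.
  apply/b1starP; split; first exact: (baire_one_inv _ _ _ _ d0 dg bg).
  exists d^-1 => x; rewrite normfV lef_pV2 ?posrE//.
  exact: lt_le_trans (dg x).
exists (MkB1star gV); apply/val_inj/funext => x.
have gx0 : g x != 0 by rewrite -normr_gt0 (lt_le_trans d0).
exact: (divff gx0).
Qed.

Theorem theorem2p1 (R : realType) (X : topologicalType) :
  open [set f : B1star R X | is_unit f].
Proof.
rewrite openE => f [b fb].
(* Adding 1 keeps [N] positive even for empty [X], where [unorm b = 0]. *)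
set N := unorm b + 1.
have N0 : 0 < N by rewrite ltr_wpDl ?unorm_ge0.
have fN x : N^-1 <= `|f x|.
  have fbx : f x * b x = 1 by have /(congr1 (fun h : B1star R X => h x)) := fb.
  rewrite -div1r ler_pdivrMr// -(normr1 R) -fbx normrM ler_wpM2l//.
  by apply: le_trans (unorm_ge b x) _; rewrite lerDl.
have d0 : 0 < N^-1 / 2 by rewrite divr_gt0 ?invr_gt0.
(* Half of the lower bound [N^-1] of [|f|] may be lost: [|g x| >= |f x| - |f x - g x|] still exceeds
   [N^-1 / 2]. *)
apply/nbhs_ballP; exists (N^-1 / 2) => //= g.
rewrite -ball_normE /= => fg.
apply: (is_unit_B1star _ _ _ _ d0) => x.
have fgx : `|f x - g x| < N^-1 / 2.
  exact: le_lt_trans (unorm_ge (f - g) x) fg.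
have := lerB_dist (f x) (g x); have := fN x; lra.
Qed.
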